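(* Let $(D,S,F)$ be a POA signature, let $E=E_0\cup E_1$ be a set of $(D\cup S,F)$-equations such that rewriting by $E_1$ modulo $E_0$ is confluent and terminating, let $[\![\_]\!]\colon 0_{E_0}\to N_{E_1/E_0}$ be the normal form homomorphism, let $h\colon 0_E\to N_{E_1/E_0}$ be the isomorphism of $(D\cup S,F)$-algebras, and let $\Gamma$ be a set of $(D,S,F)$-transitions. If $\Gamma$ is $[\![\_]\!]$-coherent then $$h^{-1}\bigl(\stackrel{*}{\longrightarrow}_{\Gamma/[\![\_]\!]}\bigr)\ \subseteq\ \stackrel{*}{\longrightarrow}_{\Gamma/E},$$ i.e. $n_1\stackrel{*}{\longrightarrow}_{\Gamma/[\![\_]\!]}n_2$ implies $h^{-1}(n_1)\stackrel{*}{\longrightarrow}_{\Gamma/E}h^{-1}(n_2)$.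
   Context: POA signatures. A POA signature is a triple $(D,S,F)$ with $D\cap S=\emptyset$ and $(D\cup S,F)$ a many-sorted algebraic signature (operation symbols $\sigma\in F_{w\to s}$, with arity $w$ and sort $s$); elements of $D$ are data sorts, elements of $S$ are system sorts. Terms and variables are those of $(D\cup S,F)$. Atoms are equations $t=t'$ between terms of the same sort, and transitions $t\Rightarrow t'$ between terms of the same system sort. A $(D,S,F)$-transition is a Horn sentence $\forall X\, H\to (t\Rightarrow t')$, where $X$ is a set of variables, $H$ is a finite conjunction of atoms (equations and/or transitions), and the atoms are over $(D\cup S,F\cup X)$. $H_=$ is the set of equations and $H_\to$ the set of transitions in $H$, viewed as sets of pairs of terms. A $(D\cup S,F)$-equation is a (possibly conditional) sentence $\forall X\,H\to(t=t')$ with $H$ a finite conjunction of equational atoms. For a sort-respecting map $\theta\colon X\to B$ into an algebra and a term $t$ over $F\cup X$, $\theta t$ is the value of $t$ in $B$ under $\theta$. Algebraic rewriting. A context $c[z]$ is a term $c$ over $(D\cup S,F\cup\{z\})$, where $z$ is a new variable, such that either $c=z$, or $c=\sigma(c_1,\dots,c_n)$ with $\sigma$ an operation symbol of $F$ and exactly one $k\in\{1,\dots,n\}$ such that $c_k$ is a context, the other $c_i$ ($i\neq k$) being just $(D\cup S,F)$-terms. Let $B$ be a $(D\cup S,F)$-algebra. For a context $c[z]$ of sort $s'$ with $z$ of sort $s$, $B_c\colon B_s\to B_{s'}$ is the identity if $c=z$, and $B_c(b)=B_\sigma(B_{c_1},\dots,B_{c_k}(b),\dots,B_{c_n})$ if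 $c=\sigma(c_1,\dots,c_k[z],\dots,c_n)$. Let $\Delta_B=\{(b,b)\mid b\in B\}$ be the diagonal, and for a relation $\Omega\subseteq B\times B$ let $$\Gamma(\Omega)=\{(B_c(\theta t),B_c(\theta t'))\mid c[z]\text{ a context whose sort is a system sort, with } z \text{ of the sort of } t,t',\ (\forall X\,H\to(t\Rightarrow t'))\in\Gamma,\ \theta\colon X\to B,\ \theta H_=\subseteq\Delta_B,\ \theta H_\to\subseteq\Omega\}.$$ Put $\Gamma_{B,0}=\Delta_B$, $\Gamma_{B,k+1}=\Gamma_{B,k}^*\cup\Gamma(\Gamma_{B,k}^* )$, where $R^*$ is the reflexive-transitive closure of $R$. Define $b\longrightarrow_{\Gamma/B}b'$ iff $(b,b')\in\Gamma(\Gamma_{B,k}^* )$ for some $k\in\omega$, and let $\stackrel{*}{\longrightarrow}_{\Gamma/B}$ be the reflexive-transitive closure of $\longrightarrow_{\Gamma/B}$ (on data sorts it is equality). Initial algebras and normal forms. For a set $E$ of equations, $0_E$ is the initial algebra in the class of $(D\cup S,F)$-algebras satisfying $E$; $\longrightarrow_{\Gamma/E}$ and $\stackrel{*}{\longrightarrow}_{\Gamma/E}$ abbreviate $\longrightarrow_{\Gamma/0_E}$ and $\stackrel{*}{\longrightarrow}_{\Gamma/0_E}$. With $E=E_0\cup E_1$, rewriting by $E_1$ modulo $E_0$ is the relation on $0_{E_0}$ obtained by applying the equations of $E_1$, oriented from left to right, inside arbitrary contexts of any sort (for conditional equations, an instance applies when the two sides of each condition rewrite to a common element, defined recursively as usual).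 Standing assumptions: this relation is confluent and terminating, so each $a\in 0_{E_0}$ has a unique normal form $[\![a]\!]$; the set $N_{E_1/E_0}\subseteq 0_{E_0}$ of normal forms is a $(D\cup S,F)$-algebra with $(N_{E_1/E_0})_\sigma(n_1,\dots,n_k)=[\![(0_{E_0})_\sigma(n_1,\dots,n_k)]\!]$; $[\![\_]\!]\colon 0_{E_0}\to N_{E_1/E_0}$ is a homomorphism (with $[\![n]\!]=n$ for $n\in N_{E_1/E_0}$); and, as given by the theory of equational rewriting, there is an isomorphism $h\colon 0_E\to N_{E_1/E_0}$. Computational relation and coherence. On $N_{E_1/E_0}$, $n_1\longrightarrow_{\Gamma/[\![\_]\!]}n_2$ iff there is $u\in 0_{E_0}$ with $n_1\longrightarrow_{\Gamma/E_0}u$ and $[\![u]\!]=n_2$; $\stackrel{*}{\longrightarrow}_{\Gamma/[\![\_]\!]}$ is its reflexive-transitive closure. $\Gamma$ is $[\![\_]\!]$-coherent when, for $a,a'\in 0_{E_0}$, $a\longrightarrow_{\Gamma/E_0}a'$ implies $[\![a]\!]\stackrel{*}{\longrightarrow}_{\Gamma/[\![\_]\!]}[\![a']\!]$. *)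

(* Defs.v *)
From Stdlib Require Export List Relations Wellfounded.

Set Implicit Arguments.
Unset Strict Implicit.
Unset Printing Implicit Defensive.

Inductive hlist (I : Type) (A : I -> Type) : list I -> Type :=
| hnil : hlist A nil
| hcons : forall i w, A i -> hlist A w -> hlist A (i :: w).

Arguments hnil {I A}.
Arguments hcons {I A i w} _ _.

Definition hmap (I : Type) (A B : I -> Type) (f : forall i, A i -> B i) :
    forall w, hlist A w -> hlist B w :=
  fix hmap w (l : hlist A w) : hlist B w :=
    match l with
    | hnil => hnil
    | hcons x l' => hcons (f _ x) (hmap _ l')
    end.

Fixpoint happ (I : Type) (A : I -> Type) (w1 w2 : list I)
    (l1 : hlist A w1) (l2 : hlist A w2) : hlist A (w1 ++ w2) :=
  match l1 in hlist _ w return hlist A (w ++ w2) with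
  | hnil => l2
  | hcons x l => hcons x (happ l l2)
  end.

(* The sorts form the sum of the two sort types, which makes data sorts and
   system sorts disjoint.  [op w s] is the set of operation symbols of arity
   [w] and sort [s]. *)
Record signature : Type := Signature {
  data_sort : Type;
  sys_sort : Type;
  op : list (data_sort + sys_sort) -> data_sort + sys_sort -> Type
}.

Definition sort (Sg : signature) : Type := (data_sort Sg + sys_sort Sg)%type.
Definition sys (Sg : signature) (s : sys_sort Sg) : sort Sg := inr s.

Inductive term (Sg : signature) (X : sort Sg -> Type) : sort Sg -> Type :=
| Var : forall s, X s -> term X s
| App : forall w s, op w s -> hlist (term X) w -> term X s.

Definition ground_term (Sg : signature) : sort Sg -> Type :=
  term (fun _ => Empty_set).

Record eq_atom (Sg : signature) (X : sort Sg -> Type) : Type := EqAtom {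
  eqa_sort : sort Sg;
  eqa_lhs : term X eqa_sort;
  eqa_rhs : term X eqa_sort
}.

Record tr_atom (Sg : signature) (X : sort Sg -> Type) : Type := TrAtom {
  tra_sort : sys_sort Sg;
  tra_lhs : term X (sys tra_sort);
  tra_rhs : term X (sys tra_sort)
}.

Inductive atom (Sg : signature) (X : sort Sg -> Type) : Type :=
| Equal : eq_atom X -> atom X
| Trans : tr_atom X -> atom X.

Record equation (Sg : signature) : Type := Equation {
  eq_vars : sort Sg -> Type;
  eq_hyps : list (eq_atom eq_vars);
  eq_concl : eq_atom eq_vars
}.

Record transition (Sg : signature) : Type := Transition {
  tr_vars : sort Sg -> Type;
  tr_hyps : list (atom tr_vars);
  tr_concl : tr_atom tr_vars
}.

Record algebra (Sg : signature) : Type := Algebra {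
  carrier :> sort Sg -> Type;
  interp : forall w s, op w s -> hlist carrier w -> carrier s
}.

Definition eval (Sg : signature) (A : algebra Sg) (X : sort Sg -> Type)
    (theta : forall s, X s -> A s) : forall s, term X s -> A s :=
  fix eval s (t : term X s) : A s :=
    match t with
    | Var x => theta _ x
    | App f ts => interp f (hmap eval ts)
    end.

Definition ground_eval (Sg : signature) (A : algebra Sg) :
    forall s, ground_term s -> A s :=
  eval (fun s (x : Empty_set) => match x with end).

Definition is_hom (Sg : signature) (A B : algebra Sg)
    (h : forall s, A s -> B s) : Prop :=
  forall w s (f : op w s) (l : hlist A w),
    h s (interp f l) = interp f (hmap h l).

Definition is_iso (Sg : signature) (A B : algebra Sg)
    (h : forall s, A s -> B s) (hinv : forall s, B s -> A s) : Prop :=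
  is_hom h /\ is_hom hinv /\
  (forall s a, hinv s (h s a) = a) /\ (forall s b, h s (hinv s b) = b).

Definition eq_atom_holds (Sg : signature) (A : algebra Sg)
    (X : sort Sg -> Type) (theta : forall s, X s -> A s) (q : eq_atom X) :
    Prop :=
  eval theta (eqa_lhs q) = eval theta (eqa_rhs q).

Definition satisfies (Sg : signature) (A : algebra Sg)
    (E : equation Sg -> Prop) : Prop :=
  forall e, E e -> forall theta : forall s, eq_vars e s -> A s,
    (forall q, In q (eq_hyps e) -> eq_atom_holds theta q) ->
    eq_atom_holds theta (eq_concl e).

Definition eq_union (Sg : signature) (E0 E1 : equation Sg -> Prop) :
    equation Sg -> Prop :=
  fun e => E0 e \/ E1 e.

Definition is_initial (Sg : signature) (E : equation Sg -> Prop)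
    (A : algebra Sg) : Prop :=
  satisfies A E /\
  forall B : algebra Sg, satisfies B E ->
    exists h : forall s, A s -> B s, is_hom h /\
      forall h' : forall s, A s -> B s, is_hom h' ->
        forall s a, h' s a = h s a.

(* [context sz s] is the type of contexts of sort [s] with a hole of sort
   [sz].  In [CApp f l c r] the immediate subterms are those of [l], then the
   context [c], then those of [r]. *)
Inductive context (Sg : signature) (sz : sort Sg) : sort Sg -> Type :=
| Hole : context sz sz
| CApp : forall w1 s1 w2 s, op (w1 ++ s1 :: w2) s ->
    hlist (@ground_term Sg) w1 -> context sz s1 ->
    hlist (@ground_term Sg) w2 -> context sz s.

Fixpoint context_eval (Sg : signature) (B : algebra Sg) (sz s : sort Sg)
    (c : context sz s) (b : B sz) : B s :=
  match c in context _ s return B s with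
  | Hole _ => b
  | CApp f l c' r =>
      interp f (happ (hmap (@ground_eval Sg B) l)
                  (hcons (context_eval c' b) (hmap (@ground_eval Sg B) r)))
  end.

Definition srel (Sg : signature) (B : sort Sg -> Type) : Type :=
  forall s, relation (B s).

Definition star (Sg : signature) (B : sort Sg -> Type) (R : srel B) : srel B :=
  fun s => clos_refl_trans (B s) (R s).

Definition joinable (Sg : signature) (B : sort Sg -> Type) (R : srel B)
    (s : sort Sg) (a b : B s) : Prop :=
  exists c, star R a c /\ star R b c.

Definition confluent (Sg : signature) (B : sort Sg -> Type) (R : srel B) :
    Prop :=
  forall s (a b c : B s), star R a b -> star R a c -> joinable R b c.

Definition terminating (Sg : signature) (B : sort Sg -> Type) (R : srel B) :
    Prop :=
  forall s, well_founded (transp (B s) (R s)).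

Definition normal (Sg : signature) (B : sort Sg -> Type) (R : srel B)
    (s : sort Sg) (a : B s) : Prop :=
  forall b, ~ R s a b.

Inductive tr_op (Sg : signature) (Gam : transition Sg -> Prop)
    (B : algebra Sg) (Om : srel B) : srel B :=
| tr_op_intro : forall (r : transition Sg)
    (theta : forall s, tr_vars r s -> B s) (s : sys_sort Sg)
    (c : context (sys (tra_sort (tr_concl r))) (sys s)),
    Gam r ->
    (forall q, In (Equal q) (tr_hyps r) -> eq_atom_holds theta q) ->
    (forall q, In (Trans q) (tr_hyps r) ->
       Om _ (eval theta (tra_lhs q)) (eval theta (tra_rhs q))) ->
    tr_op Gam Om
      (context_eval c (eval theta (tra_lhs (tr_concl r))))
      (context_eval c (eval theta (tra_rhs (tr_concl r)))).

Fixpoint tr_level (Sg : signature) (Gam : transition Sg -> Prop)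
    (B : algebra Sg) (k : nat) : srel B :=
  match k with
  | O => fun s b b' => b = b'
  | S k' => fun s b b' =>
      star (tr_level Gam (B := B) k') b b' \/
      tr_op Gam (star (tr_level Gam (B := B) k')) b b'
  end.

Definition tr_rew (Sg : signature) (Gam : transition Sg -> Prop)
    (B : algebra Sg) : srel B :=
  fun s b b' => exists k, tr_op Gam (star (tr_level Gam (B := B) k)) b b'.

Inductive eq_op (Sg : signature) (E : equation Sg -> Prop)
    (B : algebra Sg) (Om : srel B) : srel B :=
| eq_op_intro : forall (e : equation Sg)
    (theta : forall s, eq_vars e s -> B s) (s : sort Sg)
    (c : context (eqa_sort (eq_concl e)) s),
    E e ->
    (forall q, In q (eq_hyps e) ->
       joinable Om (eval theta (eqa_lhs q)) (eval theta (eqa_rhs q))) ->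
    eq_op E Om
      (context_eval c (eval theta (eqa_lhs (eq_concl e))))
      (context_eval c (eval theta (eqa_rhs (eq_concl e)))).

(* Conditional rewriting is stratified by the nesting depth of the rewritings
   used to join the conditions. *)
Fixpoint eq_level (Sg : signature) (E : equation Sg -> Prop)
    (B : algebra Sg) (k : nat) : srel B :=
  match k with
  | O => fun s b b' => False
  | S k' => eq_op E (eq_level E (B := B) k')
  end.

Definition eq_rew (Sg : signature) (E : equation Sg -> Prop)
    (B : algebra Sg) : srel B :=
  fun s b b' => exists k, eq_level E (B := B) k b b'.

(* Below, [A] is the algebra in which the rewriting by [E1] takes place, that
   is, the initial algebra of [E0]. *)

Definition nf_carrier (Sg : signature) (E1 : equation Sg -> Prop)
    (A : algebra Sg) (s : sort Sg) : Type :=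
  { n : A s | normal (eq_rew E1 (B := A)) n }.

Definition nf_val (Sg : signature) (E1 : equation Sg -> Prop)
    (A : algebra Sg) (s : sort Sg) (n : nf_carrier E1 A s) : A s :=
  proj1_sig n.

(* When the rewriting is confluent and terminating there is exactly one such
   map, up to proofs of normality. *)
Definition is_nf_map (Sg : signature) (E1 : equation Sg -> Prop)
    (A : algebra Sg) (nf : forall s, A s -> nf_carrier E1 A s) : Prop :=
  forall s (a : A s), star (eq_rew E1 (B := A)) a (nf_val (nf s a)).

Definition nf_algebra (Sg : signature) (E1 : equation Sg -> Prop)
    (A : algebra Sg) (nf : forall s, A s -> nf_carrier E1 A s) : algebra Sg :=
  {| carrier := nf_carrier E1 A;
     interp := fun w s (f : op w s) ns =>
       nf s (interp f (hmap (@nf_val Sg E1 A) ns)) |}.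

Definition nf_rew (Sg : signature) (E1 : equation Sg -> Prop)
    (A : algebra Sg) (nf : forall s, A s -> nf_carrier E1 A s)
    (Gam : transition Sg -> Prop) : srel (nf_carrier E1 A) :=
  fun s n1 n2 => exists u : A s,
    tr_rew Gam (B := A) (nf_val n1) u /\ nf s u = n2.

Definition coherent (Sg : signature) (E1 : equation Sg -> Prop)
    (A : algebra Sg) (nf : forall s, A s -> nf_carrier E1 A s)
    (Gam : transition Sg -> Prop) : Prop :=
  forall s (a a' : A s),
    tr_rew Gam (B := A) a a' -> star (nf_rew nf Gam) (nf s a) (nf s a').

(* Main.v *)
Require Import Defs.

Set Implicit Arguments.
Unset Strict Implicit.
Unset Printing Implicit Defensive.

(** Since [I] is a model of [E0], initiality of [I0] gives a homomorphism
    [g : I0 -> I].  Two facts about [g] carry the proof.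

    - Homomorphisms preserve rewriting by transitions ([hom_tr_rew]), so a step
      from [nf_val n1] to [u] in [I0] becomes a step from [g (nf_val n1)] to
      [g u] in [I].
    - [I] is also a model of [E1], so [g] identifies the two sides of each
      [E1]-rewriting step ([eq_rew_sound]), and in particular an element and
      its normal form.  Hence [n |-> g (nf_val n)] is a homomorphism from the
      normal forms to [I] ([nf_val_hom]), although [nf_val] itself is not one.
      Composed with [h] it is an endomorphism of the initial algebra [I], that
      is, the identity; so [g (nf_val n) = hinv n].

    A computation step from [n1] to [n2 = nf u] is therefore sent to a step
    from [hinv n1] to [g u = g (nf_val (nf u)) = hinv n2]. *)

(** * Homomorphisms *)

Lemma hmap_comp (I : Type) (A B C : I -> Type) (f : forall i, A i -> B i)
    (g : forall i, B i -> C i) w (l : hlist A w) :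
  hmap g (hmap f l) = hmap (fun i x => g i (f i x)) l.
Proof.
  induction l as [|i w x l IHl]; simpl; [reflexivity | now rewrite IHl].
Qed.

Lemma hmap_id (I : Type) (A : I -> Type) w (l : hlist A w) :
  hmap (fun _ x => x) l = l.
Proof.
  induction l as [|i w x l IHl]; simpl; [reflexivity | now rewrite IHl].
Qed.

Lemma hmap_happ (I : Type) (A B : I -> Type) (f : forall i, A i -> B i)
    w1 w2 (l1 : hlist A w1) (l2 : hlist A w2) :
  hmap f (happ l1 l2) = happ (hmap f l1) (hmap f l2).
Proof.
  induction l1 as [|i w x l IHl]; simpl; [reflexivity | now rewrite IHl].
Qed.

Lemma is_hom_id (Sg : signature) (A : algebra Sg) :
  is_hom (A := A) (B := A) (fun _ x => x).
Proof. intros w s f l; now rewrite hmap_id. Qed.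

Lemma is_hom_comp (Sg : signature) (A B C : algebra Sg)
    (f : forall s, A s -> B s) (g : forall s, B s -> C s) :
  is_hom f -> is_hom g -> is_hom (A := A) (B := C) (fun s x => g s (f s x)).
Proof. intros Hf Hg w s o l; now rewrite Hf, Hg, hmap_comp. Qed.

(** The target valuation is given up to pointwise equality: on ground terms the
    composite of [g] with the empty valuation is another function out of
    [Empty_set] than the empty valuation of [B]. *)
Lemma hom_eval (Sg : signature) (A B : algebra Sg)
    (g : forall s, A s -> B s) (Hg : is_hom g) (X : sort Sg -> Type)
    (theta : forall s, X s -> A s) (theta' : forall s, X s -> B s)
    (Htheta : forall s x, g s (theta s x) = theta' s x) :
  forall s (t : term X s), g s (eval theta t) = eval theta' t.
Proof.
  fix IH 2; intros s t; destruct t as [s x | w s f ts]; simpl.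
  - apply Htheta.
  - rewrite Hg; f_equal.
    clear f; induction ts as [|i w t ts IHts]; simpl; [reflexivity|].
    now rewrite IH, IHts.
Qed.

Lemma hom_eval_comp (Sg : signature) (A B : algebra Sg)
    (g : forall s, A s -> B s) (Hg : is_hom g) (X : sort Sg -> Type)
    (theta : forall s, X s -> A s) s (t : term X s) :
  g s (eval theta t) = eval (fun s x => g s (theta s x)) t.
Proof. now apply hom_eval. Qed.

Lemma hom_hmap_ground_eval (Sg : signature) (A B : algebra Sg)
    (g : forall s, A s -> B s) (Hg : is_hom g) w
    (l : hlist (@ground_term Sg) w) :
  hmap g (hmap (@ground_eval Sg A) l) = hmap (@ground_eval Sg B) l.
Proof.
  induction l as [|i w t l IHl]; simpl; [reflexivity|].
  rewrite IHl; f_equal.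
  now apply hom_eval.
Qed.

Lemma hom_context_eval (Sg : signature) (A B : algebra Sg)
    (g : forall s, A s -> B s) (Hg : is_hom g) sz s (c : context sz s)
    (a : A sz) :
  g s (context_eval c a) = context_eval c (g sz a).
Proof.
  induction c as [|w1 s1 w2 s f l c IHc r]; simpl; [reflexivity|].
  now rewrite Hg, hmap_happ; simpl; rewrite IHc, !hom_hmap_ground_eval.
Qed.

Lemma initial_endo_id (Sg : signature) (E : equation Sg -> Prop)
    (A : algebra Sg) (A_initial : is_initial E A) (f : forall s, A s -> A s)
    (Hf : is_hom f) s (a : A s) :
  f s a = a.
Proof.
  destruct A_initial as [A_sat A_univ].
  destruct (A_univ A A_sat) as [k [_ k_unique]].
  now rewrite (k_unique f Hf), <- (k_unique _ (@is_hom_id Sg A)).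
Qed.

(** * Rewriting along a homomorphism *)

Lemma star_map (Sg : signature) (A B : sort Sg -> Type)
    (f : forall s, A s -> B s) (R : srel A) (R' : srel B)
    (Hf : forall s a a', R s a a' -> R' s (f s a) (f s a')) :
  forall s a a', @star Sg A R s a a' -> star R' (f s a) (f s a').
Proof.
  intros s a a' H; induction H as [a a' H | a | a a' a'' _ IH1 _ IH2].
  - now apply rt_step, Hf.
  - apply rt_refl.
  - exact (rt_trans _ _ _ _ _ IH1 IH2).
Qed.

Lemma hom_tr_op (Sg : signature) (Gam : transition Sg -> Prop)
    (A B : algebra Sg) (g : forall s, A s -> B s) (Hg : is_hom g)
    (Om : srel A) (Om' : srel B)
    (HOm : forall s a a', Om s a a' -> Om' s (g s a) (g s a')) :
  forall s a a', tr_op Gam Om (s := s) a a' ->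
    tr_op Gam Om' (g s a) (g s a').
Proof.
  intros s a a' [r theta s' c Hr Heq Htr].
  rewrite !(hom_context_eval Hg), !(hom_eval_comp Hg).
  apply tr_op_intro; [exact Hr | |].
  - intros q Hq; unfold eq_atom_holds.
    now rewrite <- !(hom_eval_comp Hg), (Heq q Hq).
  - intros q Hq; rewrite <- !(hom_eval_comp Hg).
    now apply HOm, Htr.
Qed.

Lemma hom_tr_level (Sg : signature) (Gam : transition Sg -> Prop)
    (A B : algebra Sg) (g : forall s, A s -> B s) (Hg : is_hom g) k :
  forall s a a', tr_level Gam (B := A) k (s := s) a a' ->
    tr_level Gam (B := B) k (g s a) (g s a').
Proof.
  induction k as [|k IHk]; simpl; intros s a a' H.
  - now rewrite H.
  - destruct H as [H | H]; [left | right].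
    + exact (star_map IHk H).
    + exact (hom_tr_op Hg (star_map IHk) H).
Qed.

Lemma hom_tr_rew (Sg : signature) (Gam : transition Sg -> Prop)
    (A B : algebra Sg) (g : forall s, A s -> B s) (Hg : is_hom g) :
  forall s a a', tr_rew Gam (B := A) (s := s) a a' ->
    tr_rew Gam (B := B) (g s a) (g s a').
Proof.
  intros s a a' [k H]; exists k.
  exact (hom_tr_op Hg (star_map (hom_tr_level Hg (k := k))) H).
Qed.

Lemma star_eq (Sg : signature) (A B : sort Sg -> Type)
    (f : forall s, A s -> B s) (R : srel A)
    (Hf : forall s a a', R s a a' -> f s a = f s a') :
  forall s a a', @star Sg A R s a a' -> f s a = f s a'.
Proof.
  intros s a a' H; induction H as [a a' H | | a a' a'' _ IH1 _ IH2].
  - now apply Hf.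
  - reflexivity.
  - now transitivity (f s a').
Qed.

(** The conditions of an instance are joined by rewritings of smaller nesting
    depth, so by induction on the depth [g] sends their two sides to the same
    element; this makes the instance applicable in the model [B]. *)
Lemma eq_level_sound (Sg : signature) (E : equation Sg -> Prop)
    (A B : algebra Sg) (B_sat : satisfies B E) (g : forall s, A s -> B s)
    (Hg : is_hom g) k :
  forall s a a', eq_level E (B := A) k (s := s) a a' -> g s a = g s a'.
Proof.
  induction k as [|k IHk]; simpl; intros s a a' H; [contradiction|].
  destruct H as [e theta s c He Hcond].
  rewrite !(hom_context_eval Hg), !(hom_eval_comp Hg); f_equal.
  apply (B_sat e He); intros q Hq; unfold eq_atom_holds.
  rewrite <- !(hom_eval_comp Hg).
  destruct (Hcond q Hq) as [b [Hl Hr]].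
  now rewrite (star_eq IHk Hl), (star_eq IHk Hr).
Qed.

Lemma eq_rew_sound (Sg : signature) (E : equation Sg -> Prop)
    (A B : algebra Sg) (B_sat : satisfies B E) (g : forall s, A s -> B s)
    (Hg : is_hom g) :
  forall s a a', eq_rew E (B := A) (s := s) a a' -> g s a = g s a'.
Proof. intros s a a' [k H]; exact (eq_level_sound B_sat Hg H). Qed.

(** * Normal forms *)

Lemma hom_nf (Sg : signature) (E1 : equation Sg -> Prop) (A B : algebra Sg)
    (nf : forall s, A s -> nf_carrier E1 A s) (nf_spec : is_nf_map nf)
    (B_sat : satisfies B E1) (g : forall s, A s -> B s) (Hg : is_hom g)
    s (a : A s) :
  g s (nf_val (nf s a)) = g s a.
Proof. symmetry; exact (star_eq (eq_rew_sound B_sat Hg) (nf_spec s a)). Qed.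

(** An operation on normal forms is the operation of [A] followed by [nf], and
    [g] does not see the [nf]. *)
Lemma nf_val_hom (Sg : signature) (E1 : equation Sg -> Prop) (A B : algebra Sg)
    (nf : forall s, A s -> nf_carrier E1 A s) (nf_spec : is_nf_map nf)
    (B_sat : satisfies B E1) (g : forall s, A s -> B s) (Hg : is_hom g) :
  is_hom (A := nf_algebra nf) (B := B) (fun s n => g s (nf_val n)).
Proof.
  intros w s f ns; simpl.
  now rewrite (hom_nf nf_spec B_sat Hg), Hg, hmap_comp.
Qed.

Theorem corollary5p4
  (Sg : signature)
  (E0 E1 : equation Sg -> Prop)
  (I0 : algebra Sg) (I0_initial : is_initial E0 I0)
  (I : algebra Sg) (I_initial : is_initial (eq_union E0 E1) I)
  (E1_confluent : confluent (eq_rew E1 (B := I0)))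
  (E1_terminating : terminating (eq_rew E1 (B := I0)))
  (nf : forall s, I0 s -> nf_carrier E1 I0 s) (nf_spec : is_nf_map nf)
  (h : forall s, I s -> nf_algebra nf s)
  (hinv : forall s, nf_algebra nf s -> I s)
  (h_iso : is_iso h hinv)
  (Gam : transition Sg -> Prop)
  (Gam_coherent : coherent nf Gam) :
  forall (s : sort Sg) (n1 n2 : nf_algebra nf s),
    star (nf_rew nf Gam) n1 n2 ->
    star (tr_rew Gam (B := I)) (hinv s n1) (hinv s n2).
Proof.
  assert (I_sat0 : satisfies I E0)
    by (intros e He; apply (proj1 I_initial); now left).
  assert (I_sat1 : satisfies I E1)
    by (intros e He; apply (proj1 I_initial); now right).
  destruct (proj2 I0_initial I I_sat0) as [g [Hg _]].
  destruct h_iso as [h_hom [_ [_ hK]]].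
  assert (g_val : forall s (n : nf_algebra nf s), g s (nf_val n) = hinv s n).
  { intros s n.
    rewrite <- (hK s n) at 1.
    exact (initial_endo_id I_initial
             (is_hom_comp h_hom (nf_val_hom nf_spec I_sat1 Hg)) (hinv s n)). }
  apply star_map; intros s n1 n2 [u [Hu <-]].
  rewrite <- !g_val, (hom_nf nf_spec I_sat1 Hg).
  exact (hom_tr_rew Hg Hu).
Qed.
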